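(* For all finite sets of formulas $\Gamma,\Delta$: $\mathbf{D}^2_{\rm seq}\vdash\Gamma\Rightarrow_{\mathsf D}\Delta$ if and only if $\mathbf{D}^2_{\rm H}\vdash\bigwedge\Gamma\to\bigvee\Delta$.
   Context: Formulas are built from propositional variables and $\bot$ by $\to$ and $\Box$; other connectives are the usual classical abbreviations; the empty conjunction is $\top$ and the empty disjunction is $\bot$. $\Gamma,\Delta,\Pi,\Sigma,\ldots$ denote finite sets of formulas; commas denote union; $\Box\Gamma=\{\Box\gamma\mid\gamma\in\Gamma\}$. GL-sequents $\Gamma\Rightarrow\Delta$ and D-sequents $\Gamma\Rightarrow_{\mathsf D}\Delta$ are tagged pairs of finite sets of formulas. For each arrow $\blacktriangleright\in\{\Rightarrow,\Rightarrow_{\mathsf D}\}$, $\mathbf{LK}_{\blacktriangleright}$ has initial sequents $\varphi\blacktriangleright\varphi$ and $\bot\blacktriangleright\ $ (empty right side) and the rules: (weakening) from $\Gamma\blacktriangleright\Delta$ infer $\Gamma'\blacktriangleright\Delta'$, where $\Gamma\subseteq\Gamma'$, $\Delta\subseteq\Delta'$; ($\to$left) from $\Gamma\blacktriangleright\Delta,\varphi$ and $\psi,\Gamma\blacktriangleright\Delta$ infer $\varphi\to\psi,\Gamma\blacktriangleright\Delta$; ($\to$right) from $\varphi,\Gamma\blacktriangleright\Delta,\psi$ infer $\Gamma\blacktriangleright\Delta,\varphi\to\psi$; (cut) from $\Gamma\blacktriangleright\Delta,\varphi$ and $\varphi,\Pi\blacktriangleright\Sigma$ infer $\Gamma,\Pi\blacktriangleright\Delta,\Sigma$.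 Further rules: (GL$\Box$) from $\Gamma,\Box\Gamma,\Box\varphi\Rightarrow\varphi$ infer $\Box\Gamma\Rightarrow\Box\varphi$; (GLtoD) from $\Gamma,\Box\Gamma\Rightarrow\Box\Delta$ infer $\Box\Gamma\Rightarrow_{\mathsf D}\Box\Delta$. $\mathbf{D}^2_{\rm seq}$ consists of $\mathbf{LK}_{\Rightarrow}$, $\mathbf{LK}_{\Rightarrow_{\mathsf D}}$, (GL$\Box$), (GLtoD). Hilbert systems. $\mathbf{GL}_{\rm H}$: axioms are all tautologies, $\Box(\varphi\to\psi)\to(\Box\varphi\to\Box\psi)$, $\Box(\Box\varphi\to\varphi)\to\Box\varphi$; rules are modus ponens and necessitation (from $\varphi$ infer $\Box\varphi$). $\mathbf{D}^2_{\rm H}$: axioms are all tautologies and all formulas of the form $\bigwedge\Box\Gamma\to\bigvee\Box\Delta$ such that $\bigwedge(\Gamma,\Box\Gamma)\to\bigvee\Box\Delta$ is a theorem of $\mathbf{GL}_{\rm H}$; the only rule is modus ponens. *)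

(* Defs.v *)
From HB Require Import structures.
From mathcomp Require Import all_boot.
From mathcomp Require Import finmap.

Set Implicit Arguments.
Unset Strict Implicit.
Unset Printing Implicit Defensive.

Local Open Scope fset_scope.

Inductive form : Type :=
| Var of nat
| Bot
| Imp of form & form
| Box of form.

(* Finite sets {fset form} need a choiceType structure on form, obtained by
   encoding formulas as trees. *)
Fixpoint form_encode (A : form) : GenTree.tree nat :=
  match A with
  | Var p => GenTree.Leaf p
  | Bot => GenTree.Node 0 [::]
  | Imp A B => GenTree.Node 1 [:: form_encode A; form_encode B]
  | Box A => GenTree.Node 2 [:: form_encode A]
  end.

Fixpoint form_decode (t : GenTree.tree nat) : form :=
  match t with
  | GenTree.Leaf p => Var p
  | GenTree.Node 1 [:: t; u] => Imp (form_decode t) (form_decode u)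
  | GenTree.Node 2 [:: t] => Box (form_decode t)
  | GenTree.Node _ _ => Bot
  end.

Lemma form_encodeK : cancel form_encode form_decode.
Proof. by elim=> //= [A -> B ->|A ->]. Qed.

HB.instance Definition _ := Countable.copy form (can_type form_encodeK).

Definition Neg (A : form) : form := Imp A Bot.
Definition Top : form := Neg Bot.
Definition And (A B : form) : form := Neg (Imp A (Neg B)).
Definition Or (A B : form) : form := Imp (Neg A) B.

Fixpoint conj_seq (s : seq form) : form :=
  match s with
  | [::] => Top
  | [:: A] => A
  | A :: s' => And A (conj_seq s')
  end.

Fixpoint disj_seq (s : seq form) : form :=
  match s with
  | [::] => Bot
  | [:: A] => A
  | A :: s' => Or A (disj_seq s')
  end.

(* The members of a finite set are taken in the order of its canonical
   duplicate-free enumeration. *)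
Definition Conj (G : {fset form}) : form := conj_seq (enum_fset G).
Definition Disj (G : {fset form}) : form := disj_seq (enum_fset G).

Definition boxes (G : {fset form}) : {fset form} := [fset Box A | A in G].

(* Variables and boxed formulas are both atoms for the truth-functional
   evaluation, so that all modal substitution instances of propositional
   tautologies are tautologies. *)
Fixpoint eval (v : form -> bool) (A : form) : bool :=
  match A with
  | Var _ | Box _ => v A
  | Bot => false
  | Imp B C => eval v B ==> eval v C
  end.

Definition tautology (A : form) : Prop := forall v : form -> bool, eval v A.

Inductive GL_H : form -> Prop :=
| GL_H_taut A : tautology A -> GL_H A
| GL_H_K A B : GL_H (Imp (Box (Imp A B)) (Imp (Box A) (Box B)))
| GL_H_Lob A : GL_H (Imp (Box (Imp (Box A) A)) (Box A))
| GL_H_mp A B : GL_H (Imp A B) -> GL_H A -> GL_H B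
| GL_H_nec A : GL_H A -> GL_H (Box A).

Inductive D2_H : form -> Prop :=
| D2_H_taut A : tautology A -> D2_H A
| D2_H_GL (G D : {fset form}) :
    GL_H (Imp (Conj (G `|` boxes G)) (Disj (boxes D))) ->
    D2_H (Imp (Conj (boxes G)) (Disj (boxes D)))
| D2_H_mp A B : D2_H (Imp A B) -> D2_H A -> D2_H B.

Inductive arrow : Type := GLarrow | Darrow.

(* D2_seq a G D: the sequent with antecedent G, succedent D and tag a is
   derivable. *)
Inductive D2_seq : arrow -> {fset form} -> {fset form} -> Prop :=
| D2_seq_id a A : D2_seq a [fset A] [fset A]
| D2_seq_bot a : D2_seq a [fset Bot] fset0
| D2_seq_weak a (G G' D D' : {fset form}) :
    G `<=` G' -> D `<=` D' -> D2_seq a G D -> D2_seq a G' D'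
| D2_seq_impL a (G D : {fset form}) A B :
    D2_seq a G (A |` D) -> D2_seq a (B |` G) D -> D2_seq a (Imp A B |` G) D
| D2_seq_impR a (G D : {fset form}) A B :
    D2_seq a (A |` G) (B |` D) -> D2_seq a G (Imp A B |` D)
| D2_seq_cut a (G D P S : {fset form}) A :
    D2_seq a G (A |` D) -> D2_seq a (A |` P) S -> D2_seq a (G `|` P) (D `|` S)
| D2_seq_GLBox (G : {fset form}) A :
    D2_seq GLarrow (Box A |` (G `|` boxes G)) [fset A] ->
    D2_seq GLarrow (boxes G) [fset Box A]
| D2_seq_GLtoD (G D : {fset form}) :
    D2_seq GLarrow (G `|` boxes G) (boxes D) ->
    D2_seq Darrow (boxes G) (boxes D).

(* Main.v *)
Require Import Defs.
From mathcomp Require Import all_boot.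
From mathcomp Require Import finmap.

(** Both calculi are compared through propositional valuations that treat boxed
formulas as atoms. In the Hilbert systems, tautologies and modus ponens give
closure under propositional consequence. In the sequent calculus, the same
closure is obtained by Kalmar's method: every valuation yields a derivable
sequent of literals, and the literals are then removed by cut. What remains are
the modal rules; the only modal work is the derivation of the rule of GL from
Loeb's axiom, which uses transitivity [Box A -> Box (Box A)]. *)

Set Implicit Arguments.
Unset Strict Implicit.
Unset Printing Implicit Defensive.

Local Open Scope fset_scope.

(** * Sequents read as formulas under a valuation *)

Lemma eval_conj_seq v s : eval v (conj_seq s) = all (eval v) s.
Proof.
elim: s => [|A [|B s] IHs] //; first by rewrite /= andbT.
by rewrite [LHS]/= !implybF negb_imply negbK -/(conj_seq (B :: s)) IHs.
Qed.

Lemma eval_disj_seq v s : eval v (disj_seq s) = has (eval v) s.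
Proof.
elim: s => [|A [|B s] IHs] //; first by rewrite /= orbF.
by rewrite [LHS]/= implybF implyNb -/(disj_seq (B :: s)) IHs.
Qed.

Definition seq_form (G D : {fset form}) : form := Imp (Conj G) (Disj D).

Lemma seq_formP v (G D : {fset form}) :
  reflect ({in G, forall A, eval v A} -> exists2 A, A \in D & eval v A)
          (eval v (seq_form G D)).
Proof.
rewrite /seq_form /= eval_conj_seq eval_disj_seq.
apply: (iffP implyP) => [h hG | h /allP hG]; last by apply/hasP/h.
by apply/hasP/h/allP.
Qed.

(** * Propositional and modal reasoning in the Hilbert systems *)

Definition hilbert (a : arrow) : form -> Prop :=
  if a is GLarrow then GL_H else D2_H.

Lemma hilbert_taut a A : tautology A -> hilbert a A.
Proof. by case: a; [apply: GL_H_taut | apply: D2_H_taut]. Qed.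

Lemma hilbert_mp a A B : hilbert a (Imp A B) -> hilbert a A -> hilbert a B.
Proof. by case: a; [apply: GL_H_mp | apply: D2_H_mp]. Qed.

Lemma hilbert_entail a A B :
  hilbert a A -> (forall v, eval v A -> eval v B) -> hilbert a B.
Proof.
by move=> hA AB; apply: hilbert_mp hA; apply: hilbert_taut => v; apply/implyP/AB.
Qed.

Lemma hilbert_entail2 a A B C :
    hilbert a A -> hilbert a B ->
  (forall v, eval v A -> eval v B -> eval v C) -> hilbert a C.
Proof.
move=> hA hB ABC; apply: hilbert_mp hB; apply: hilbert_entail hA _ => v vA.
by apply/implyP/ABC.
Qed.

Definition imps (s : seq form) (A : form) : form := foldr Imp A s.

Lemma eval_imps v s A : eval v (imps s A) = (all (eval v) s ==> eval v A).
Proof. by elim: s => //= B s ->; case: (eval v B). Qed.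

(** Repeated modus ponens under a fixed antecedent [C]; it stands in for a deduction theorem. *)
Lemma hilbert_imps_elim a C s A :
    {in s, forall B, hilbert a (Imp C B)} ->
  hilbert a (Imp C (imps s A)) -> hilbert a (Imp C A).
Proof.
elim: s => //= B s IHs hs hA; apply: IHs => [E sE|].
  by apply: hs; rewrite inE sE orbT.
apply: (hilbert_entail2 (hs B _) hA) => [|v /=]; first by rewrite mem_head.
by case: (eval v C) => //= ->.
Qed.

Lemma GL_H_box_imps s A :
  GL_H (Imp (Box (imps s A)) (imps (map Box s) (Box A))).
Proof.
elim: s => /= [|B s IHs]; first by apply: GL_H_taut => v; apply: implybb.
apply: (@hilbert_entail2 GLarrow _ _ _ (GL_H_K B (imps s A)) IHs) => v /=.
by case: (v (Box (Imp _ _))) => //= /implyP vB /implyP vs; apply/implyP => /vB.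
Qed.

Lemma GL_H_box_mono A B : GL_H (Imp A B) -> GL_H (Imp (Box A) (Box B)).
Proof. by move/GL_H_nec; apply: GL_H_mp; apply: GL_H_K. Qed.

(* Loeb's axiom for [A /\ Box A]. *)
Lemma GL_H_box4 A : GL_H (Imp (Box A) (Box (Box A))).
Proof.
pose X := And A (Box A).
have XA : GL_H (Imp (Box X) (Box A)).
  by apply/GL_H_box_mono/GL_H_taut => v /=; case: (eval v A); case: (v _).
have XBA : GL_H (Imp (Box X) (Box (Box A))).
  apply/GL_H_box_mono/GL_H_taut => v /=.
  by case: (eval v A); case: (v _).
(* Under [A], [Box X] gives [Box A] by [XA], hence both halves of [X]; so [A] implies
   [Imp (Box X) X], and this is boxed. *)
have AX : GL_H (Imp (Box A) (Box (Imp (Box X) X))).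
  apply/GL_H_box_mono; apply: (@hilbert_entail GLarrow _ _ XA) => v /=.
  by case: (eval v A) => //=; case: (v (Box A)) => //=; case: (v _).
have AXX := @hilbert_entail2 GLarrow _ _ (Imp (Box A) (Box X)) AX (GL_H_Lob X).
apply: (@hilbert_entail2 GLarrow _ _ _ (AXX _) XBA) => v /=;
  by case: (v (Box A)) => //= ->.
Qed.

(** Currying the premise, boxing it and distributing the box leaves the assumptions [Box B] and
    [Box (Box B)] for [B] in [G]. The latter follow from the former by transitivity, and Loeb's
    axiom removes the diagonal formula [Box A]. *)
Lemma GL_H_GLBox (G : {fset form}) A :
    GL_H (seq_form (Box A |` (G `|` boxes G)) [fset A]) ->
  GL_H (seq_form (boxes G) [fset Box A]).
Proof.
move=> hA; set C := Conj (boxes G).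
pose s : seq form := enum_fset G; pose t := s ++ map Box s.
have CB B : B \in s -> GL_H (Imp C (Box B)).
  move=> sB; apply: GL_H_taut => v /=; rewrite eval_conj_seq.
  by apply/implyP => /allP/(_ (Box B)); apply; apply: in_imfset.
have ht : GL_H (imps t (Imp (Box A) A)).
  apply: (@hilbert_entail GLarrow _ _ hA) => v /seq_formP h.
  rewrite eval_imps all_cat; apply/implyP => /andP[/allP vs /allP vBs].
  apply/implyP => vA; case: h => [B|B]; last by rewrite inE => /eqP->.
  rewrite !inE => /orP[/eqP->//|/orP[/vs//|/imfsetP[E sE ->]]].
  by apply: vBs; apply: map_f.
have CA : GL_H (Imp C (Box (Imp (Box A) A))).
  apply: (@hilbert_imps_elim GLarrow C (map Box t)) => [_ /mapP[E tE ->]|].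
    move: tE; rewrite mem_cat => /orP[/CB//|/mapP[B sB ->]].
    apply: (@hilbert_entail2 GLarrow _ _ _ (CB B sB) (GL_H_box4 B)) => v /=.
    by case: (eval v C) => //= ->.
  have h := GL_H_mp (GL_H_box_imps _ _) (GL_H_nec ht).
  by apply: (@hilbert_entail GLarrow _ _ h) => v /= ->; rewrite implybT.
apply: (@hilbert_entail2 GLarrow _ _ _ CA (GL_H_Lob A)) => v /=.
rewrite -/C => /implyP vC /implyP vA; apply/seq_formP => vG.
exists (Box A); rewrite ?inE //; apply/vA/vC.
by rewrite eval_conj_seq; apply/allP.
Qed.

(** The propositional rules preserve truth at each valuation, so both arrows are treated at once.
    For (GLtoD) the induction hypothesis is exactly the side condition of the modal axiom of
    [D2_H]. *)
Lemma D2_seq_sound a (G D : {fset form}) : D2_seq a G D -> hilbert a (seq_form G D).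
Proof.
elim=> {a G D}.
- move=> a A; apply: hilbert_taut => v; apply/seq_formP => h.
  by exists A; [|apply: h]; rewrite inE.
- move=> a; apply: hilbert_taut => v; apply/seq_formP => /(_ Bot).
  by rewrite inE eqxx => /(_ isT).
- move=> a G G' D D' /fsubsetP GG' /fsubsetP DD' _ IH.
  apply: hilbert_entail IH _ => v /seq_formP h; apply/seq_formP => hG'.
  by have [A /GG'/hG'//|A /DD' ? ?] := h; exists A.
- move=> a G D A B _ IHA _ IHB.
  apply: hilbert_entail2 IHA IHB _ => v /seq_formP hA /seq_formP hB.
  apply/seq_formP => hG.
  have vG : {in G, forall E, eval v E}.
    by move=> E GE; apply: hG; rewrite !inE GE orbT.
  have /implyP vAB : eval v (Imp A B) by apply: hG; rewrite !inE eqxx.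
  have [E] := hA vG; rewrite !inE => /orP[/eqP->{E} vA|DE vE]; last by exists E.
  by apply: hB => E; rewrite !inE => /orP[/eqP->|/vG//]; apply: vAB.
- move=> a G D A B _ IH; apply: hilbert_entail IH _ => v /seq_formP h.
  apply/seq_formP => vG; case vA: (eval v A); last first.
    by exists (Imp A B); rewrite /= ?vA // !inE eqxx.
  have [E|E] := h; first by rewrite !inE => /orP[/eqP->|/vG].
  rewrite !inE => /orP[/eqP-> vB|DE vE]; last by exists E; rewrite ?inE ?DE ?orbT.
  by exists (Imp A B); rewrite /= ?vB ?implybT // !inE eqxx.
- move=> a G D P S A _ IHl _ IHr.
  apply: hilbert_entail2 IHl IHr _ => v /seq_formP hl /seq_formP hr.
  apply/seq_formP => vGP.
  have [E GE|E] := hl; first by apply: vGP; rewrite inE GE.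
  rewrite !inE => /orP[/eqP-> vA|DE vE]; last by exists E; rewrite ?inE ?DE.
  have [E'|E' SE vE] := hr; last by exists E'; rewrite ?inE ?SE ?orbT.
  by rewrite !inE => /orP[/eqP->//|PE]; apply: vGP; rewrite inE PE orbT.
- by move=> G A _; apply: GL_H_GLBox.
- by move=> G D _; apply: D2_H_GL.
Qed.

(** * Propositional completeness of the sequent calculus *)

Lemma D2_seq_ax a (G D : {fset form}) A : A \in G -> A \in D -> D2_seq a G D.
Proof.
by move=> GA DA; apply: D2_seq_weak (D2_seq_id a A); rewrite fsub1set.
Qed.

Lemma D2_seq_cut_same a (G D : {fset form}) A :
  D2_seq a G (A |` D) -> D2_seq a (A |` G) D -> D2_seq a G D.
Proof. by move=> h1 h2; have := D2_seq_cut h1 h2; rewrite !fsetUid. Qed.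

Lemma D2_seq_cutsl a (G D : {fset form}) (s : seq form) :
    {in s, forall A, D2_seq a G (A |` D)} ->
  D2_seq a (G `|` [fset A in s]) D -> D2_seq a G D.
Proof.
elim: s G => [|A s IHs] G hs hD.
  apply: D2_seq_weak hD => //; apply/fsubsetP => A.
  by rewrite !inE orbF.
have hA := hs A (mem_head _ _).
apply: (D2_seq_cut_same hA); apply: IHs => [B sB|].
  apply: D2_seq_weak (hs B _); rewrite ?fsubsetUr //.
  by rewrite inE sB orbT.
apply: D2_seq_weak hD => //; apply/fsubsetP => B.
by rewrite !inE => /or3P[] ->; rewrite ?orbT.
Qed.

Lemma D2_seq_cutsr a (G D : {fset form}) (s : seq form) :
    {in s, forall A, D2_seq a (A |` G) D} ->
  D2_seq a G (D `|` [fset A in s]) -> D2_seq a G D.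
Proof.
elim: s D => [|A s IHs] D hs hD.
  apply: D2_seq_weak hD => //; apply/fsubsetP => A.
  by rewrite !inE orbF.
have hA := hs A (mem_head _ _).
apply: D2_seq_cut_same hA; apply: IHs => [B sB|].
  apply: D2_seq_weak (hs B _); rewrite ?fsubsetUr //.
  by rewrite inE sB orbT.
apply: D2_seq_weak hD => //; apply/fsubsetP => B.
by rewrite !inE => /or3P[] ->; rewrite ?orbT.
Qed.

Lemma D2_seq_split a (s : seq form) (G D : {fset form}) :
    (forall v : form -> bool,
       D2_seq a (G `|` [fset A in s | v A]) (D `|` [fset A in s | ~~ v A])) ->
  D2_seq a G D.
Proof.
elim: s G D => [|A s IHs] G D h.
  by apply: D2_seq_weak (h xpredT); apply/fsubsetP => A; rewrite !inE orbF.
apply: (@D2_seq_cut_same a G D A); apply: IHs => v.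
  (* The valuation is overridden at [A], to false in this branch of the cut and to true in the
     other, so that [A] lands on the side where the cut puts it. *)
  apply: D2_seq_weak (h (fun B => (B != A) && v B)); apply/fsubsetP => B;
    by rewrite !inE /=; case: (_ \in _); case: (B == A); rewrite ?andbF ?orbF ?orbT.
apply: D2_seq_weak (h (fun B => (B == A) || v B)); apply/fsubsetP => B;
  by rewrite !inE /=; case: (_ \in _); case: (B == A); rewrite ?andbF ?orbF ?orbT.
Qed.

Fixpoint atoms (A : form) : seq form :=
  match A with
  | Var _ | Box _ => [:: A]
  | Bot => [::]
  | Imp B C => atoms B ++ atoms C
  end.

(** Falsity of [A] is expressed by placing it on the left, so each case of an implication is one
    implication rule. A list [s] larger than [atoms A] lets several formulas share the same
    literals. *)
Lemma D2_seq_kalmar a (s : seq form) v A :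
    {subset atoms A <= s} ->
  let P := [fset B in s | v B] in let N := [fset B in s | ~~ v B] in
  if eval v A then D2_seq a P (A |` N) else D2_seq a (A |` P) N.
Proof.
move=> As P N; elim: A As => [p||A IHA B IHB|A _] /= As.
- have sp := As _ (mem_head _ _); case: ifPn => vp.
    by apply: (@D2_seq_ax _ _ _ (Var p)); rewrite !inE ?eqxx ?sp.
  by apply: (@D2_seq_ax _ _ _ (Var p)); rewrite !inE ?eqxx ?sp.
- by apply: D2_seq_weak (D2_seq_bot a); rewrite ?fsub0set ?fsubsetUl.
- have sA : {subset atoms A <= s}.
    by move=> E AE; apply: As; rewrite mem_cat AE.
  have sB : {subset atoms B <= s}.
    by move=> E BE; apply: As; rewrite mem_cat BE orbT.
  case: (eval v A) (eval v B) (IHA sA) (IHB sB) => [] [] /= hA hB.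
  + by apply: D2_seq_impR; apply: D2_seq_weak hB; rewrite ?fsubsetUr.
  + exact: D2_seq_impL.
  + by apply: D2_seq_impR; apply: D2_seq_weak hB; rewrite ?fsubsetUr.
  + by apply: D2_seq_impR; apply: D2_seq_weak hA; rewrite ?fsubsetUr.
have sA := As _ (mem_head _ _); case: ifPn => vA.
  by apply: (@D2_seq_ax _ _ _ (Box A)); rewrite !inE ?eqxx ?sA.
by apply: (@D2_seq_ax _ _ _ (Box A)); rewrite !inE ?eqxx ?sA.
Qed.

(** By [D2_seq_split] it suffices to treat each valuation [v] with its literals [P], [N] added. Then
    either [v] satisfies the target, and one member of it suffices, or [v] refutes both sequents,
    and [P], [N] alone are derivable. *)
Lemma D2_seq_entail a (G D G' D' : {fset form}) :
    D2_seq a G D ->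
    (forall v, eval v (seq_form G D) -> eval v (seq_form G' D')) ->
  D2_seq a G' D'.
Proof.
move=> hGD hv.
pose X := (G `|` D) `|` (G' `|` D').
pose s := flatten [seq atoms A | A <- enum_fset X].
have sX A : A \in X -> {subset atoms A <= s}.
  by move=> XA B AB; apply/flatten_mapP; exists A.
apply: (@D2_seq_split a s) => v.
set P := [fset A in s | v A]; set N := [fset A in s | ~~ v A].
have kT A : A \in X -> eval v A -> D2_seq a P (A |` N).
  by move=> XA vA; have := @D2_seq_kalmar a s v A (sX A XA); rewrite vA.
have kF A : A \in X -> ~~ eval v A -> D2_seq a (A |` P) N.
  move=> XA /negbTE vA.
  by have := @D2_seq_kalmar a s v A (sX A XA); rewrite vA.
have [/seq_formP h'|nh'] := boolP (eval v (seq_form G' D')).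
  have [/allP vG'|/allPn[A GA vA]] := boolP (all (eval v) (enum_fset G')).
    have [A DA vA] := h' vG'.
    apply: D2_seq_weak (kT A _ vA); rewrite ?fsubsetUr //.
      by rewrite fsubUset fsub1set inE DA fsubsetUr.
    by rewrite !inE DA !orbT.
  apply: D2_seq_weak (kF A _ vA); rewrite ?fsubsetUr //.
    by rewrite fsubUset fsub1set inE GA fsubsetUr.
  by rewrite !inE (_ : A \in G') ?orbT.
(* All of [G] is true and all of [D] false at [v], so Kalmar's lemma allows every member of the
   given sequent to be cut away. *)
have {hv nh'} : ~~ eval v (seq_form G D) by apply: contra nh'; apply: hv.
rewrite /= eval_conj_seq eval_disj_seq negb_imply.
case/andP=> /allP vG /hasPn vD.
apply: (@D2_seq_weak a P _ N); rewrite ?fsubsetUr //.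
apply: (@D2_seq_cutsl a P N (enum_fset G)) => [A GA|].
  by apply: kT (vG A GA); rewrite !inE (_ : A \in G).
apply: (@D2_seq_cutsr a _ N (enum_fset D)) => [A DA|].
  apply: D2_seq_weak (kF A _ (vD A DA)) => //; first by rewrite fsetUS ?fsubsetUl.
  by rewrite !inE (_ : A \in D) ?orbT.
by apply: D2_seq_weak hGD; apply/fsubsetP => A hA; rewrite !inE hA orbT.
Qed.

Lemma D2_seq_valid a (G D : {fset form}) :
  (forall v, eval v (seq_form G D)) -> D2_seq a G D.
(* Any derivable sequent would serve as premise here. *)
Proof. by move=> h; apply: D2_seq_entail (D2_seq_id a Bot) _ => v _. Qed.

Lemma eval_seq_form0 v A : eval v (seq_form fset0 [fset A]) = eval v A.
Proof.
apply/seq_formP/idP => [h|vA _]; last by exists A; rewrite ?inE.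
by have [//|B] := h; rewrite inE => /eqP->.
Qed.

Lemma D2_seq_seq_form a (G D : {fset form}) :
  D2_seq a fset0 [fset seq_form G D] <-> D2_seq a G D.
Proof.
by split=> h; apply: D2_seq_entail h _ => v; rewrite eval_seq_form0.
Qed.

Lemma D2_seq_taut a A : tautology A -> D2_seq a fset0 [fset A].
Proof. by move=> hA; apply: D2_seq_valid => v; rewrite eval_seq_form0. Qed.

Lemma D2_seq_mp a A B :
    D2_seq a fset0 [fset Imp A B] -> D2_seq a fset0 [fset A] ->
  D2_seq a fset0 [fset B].
Proof.
move=> hAB hA; apply: (@D2_seq_cut_same _ _ _ A).
  by apply: D2_seq_weak hA; rewrite ?fsubsetUl.
apply: D2_seq_entail hAB _ => v; rewrite eval_seq_form0 => /implyP vAB.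
apply/seq_formP => vA; exists B; rewrite ?inE //.
by apply/vAB/vA; rewrite !inE eqxx.
Qed.

(** * From Hilbert proofs to sequent derivations *)

Lemma GL_H_D2_seq A : GL_H A -> D2_seq GLarrow fset0 [fset A].
Proof.
elim=> {A} [A /D2_seq_taut//|A B|A|A B _ + _|A _ hA]; last 2 first.
- exact: D2_seq_mp.
(* Necessitation is (GLBox) with no side formulas. *)
- rewrite (_ : fset0 = boxes fset0); last by rewrite /boxes imfset0.
  by apply: D2_seq_GLBox; apply: D2_seq_weak hA; rewrite ?fsub0set.
- have h : D2_seq GLarrow (boxes [fset Imp A B; A]) [fset Box B].
    apply/D2_seq_GLBox/D2_seq_valid => v; apply/seq_formP => h.
    exists B; rewrite ?inE //.
    have /implyP : eval v (Imp A B) by apply: h; rewrite !inE eqxx !orbT.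
    by apply; apply: h; rewrite !inE eqxx !orbT.
  apply: D2_seq_entail h _ => v /seq_formP h; rewrite eval_seq_form0.
  apply/implyP => vAB; apply/implyP => vA.
  have [E|E] := h; last by rewrite inE => /eqP->.
  by case/imfsetP => F /=; rewrite !inE => /orP[]/eqP-> ->.
(* The diagonal formula [Box A] of (GLBox) makes the premise propositionally valid: with
   [Imp (Box A) A] it yields [A]. *)
have h : D2_seq GLarrow (boxes [fset Imp (Box A) A]) [fset Box A].
  apply/D2_seq_GLBox/D2_seq_valid => v; apply/seq_formP => h.
  exists A; rewrite ?inE //.
  have /implyP : eval v (Imp (Box A) A) by apply: h; rewrite !inE eqxx !orbT.
  by apply; apply: (h (Box A)); rewrite !inE eqxx.
apply: D2_seq_entail h _ => v /seq_formP h; rewrite eval_seq_form0.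
apply/implyP => vA; have [E|E] := h; last by rewrite inE => /eqP->.
by case/imfsetP => F /=; rewrite inE => /eqP-> ->.
Qed.

(** A modal axiom carries a proof in [GL_H]; translated and read back as a sequent, that proof
    supplies the premise of (GLtoD). *)
Lemma D2_H_D2_seq A : D2_H A -> D2_seq Darrow fset0 [fset A].
Proof.
elim=> {A} [A /D2_seq_taut//|G D hGD|A B _ + _]; last exact: D2_seq_mp.
by apply/D2_seq_seq_form/D2_seq_GLtoD/D2_seq_seq_form/GL_H_D2_seq.
Qed.

Theorem proposition6p1 (G D : {fset form}) :
  D2_seq Darrow G D <-> D2_H (Imp (Conj G) (Disj D)).
Proof.
split; first exact: D2_seq_sound.
by move/D2_H_D2_seq/D2_seq_seq_form.
Qed.
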